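(* Let $k\ge 3$. Every ALE-based (avoid-longest-edge) online exploration strategy with $k$ agents has competitive ratio at least $2$ in the time model on the class of tadpole graphs; i.e. for every such strategy and every $c<2$ there is a tadpole graph $G$ and a start node $s$ on which its exploration time exceeds $c\cdot opt(G,s,k)$.
   Context: Multi-agent online graph exploration: an undirected connected graph $G=(V,E)$ with positive edge lengths $l(e)$ and distinctly labelled nodes is initially unknown. $k$ agents start at a node $s$; initially they know $s$, its incident edges (with their lengths) and its neighbours. Whenever an agent visits a node $v$ for the first time, all edges incident to $v$ (with lengths) and the neighbours of $v$ are revealed. All agents share all information instantly, have unlimited computational power, move at unit speed (traversing $e$ takes time $l(e)$), and may wait at nodes. The exploration is finished when every node has been visited by some agent and all agents are back at $s$. Time model: the cost is the time at which the exploration is finished. For an instance, $opt(G,s,k)$ is the minimum cost of an exploration by $k$ agents with full prior knowledge of $G$; an online strategy $A$ has competitive ratio $c$ on a graph class if $c$ is the supremum of $\mathrm{cost}_A(G,s,k)/opt(G,s,k)$ over all $G$ in the class and $s\in V$. A tadpole graph consists of a cycle together with a path (the tail, with at least one edge) attached to one cycle node (the intersection, of degree 3); the other end of the tail has degree 1. An ALE-based strategy is one that tries to avoid the longest edge: as long as unvisited nodes remain, an agent only traverses an edge leading to an unvisited node if no currently visible edge (incident to a current agent position) leading to an unvisited node is strictly shorter. *)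

(* Defs.v *)
From HB Require Import structures.
From mathcomp Require Import all_boot all_order all_algebra.
From mathcomp Require Import finmap.
From mathcomp Require Import boolp classical_sets reals constructive_ereal ereal.
Set Implicit Arguments.
Unset Strict Implicit.
Unset Printing Implicit Defensive.
Import Order.TTheory GRing.Theory Num.Theory.
Local Open Scope ring_scope.

(* A node is identified with its label, a natural number, so that one and the
   same online strategy can be run on every graph. *)
Record wgraph (R : realType) := WGraph {
  nodes : {fset nat};
  adj : rel nat;
  len : nat -> nat -> R;
  adj_nodes : forall u v, adj u v -> (u \in nodes) && (v \in nodes);
  adj_sym : symmetric adj;
  adj_irr : irreflexive adj;
  len_sym : forall u v, adj u v -> len u v = len v u;
  len_gt0 : forall u v, adj u v -> 0 < len u v;
  adj_connected : forall u v, u \in nodes -> v \in nodes ->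
    exists p : seq nat, path adj u p && (last u p == v)
}.

Definition consecutive (p : seq nat) (u v : nat) : bool :=
  infix [:: u; v] p || infix [:: v; u] p.

(* x is the intersection, x :: c lists the nodes of the cycle in cyclic order
   and x :: t lists the nodes of the tail, starting from the intersection. *)
Definition tadpole (R : realType) (G : wgraph R) : Prop :=
  exists (x : nat) (c t : seq nat),
    [/\ (3 <= size (x :: c))%N, (1 <= size t)%N, uniq (x :: c ++ t),
        nodes G =i x :: c ++ t
      & forall u v, adj G u v =
          consecutive (rcons (x :: c) x) u v || consecutive (x :: t) u v].

(* [Transit u v a]: traversing the edge uv from u to v, reaching v at time a. *)
Inductive status (R : realType) :=
  | At of nat
  | Transit of nat & nat & R.
Arguments At {R} _.

Definition position (R : realType) (x : status R) : option nat :=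
  if x is At v then Some v else None.

Definition arrival (R : realType) (x : status R) : option R :=
  if x is Transit _ _ a then Some a else None.

Record state (R : realType) (k : nat) := State {
  now : R;
  agents : 'I_k -> status R;
  visited : pred nat
}.

Definition init_state (R : realType) (k : nat) (s : nat) : state R k :=
  State 0 (fun=> At s) (pred1 s).

(* Decisions are taken at time 0, whenever some agent reaches a node, and at
   freely chosen further instants.  [go i = Some w] sends agent i, if it is at
   a node, along the edge to the neighbour w; [go i = None] makes it wait.
   [timer = Some d] with d > 0 asks for a new decision after d time units, in
   case no agent reaches a node before. *)
Record decision (R : realType) (k : nat) := Decision {
  go : 'I_k -> option nat;
  timer : option R
}.

(* Agent i, in state st, obeys decision d by starting to traverse edge uw. *)
Definition departs (R : realType) (k : nat) (G : wgraph R) (st : state R k)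
    (d : decision R k) (i : 'I_k) (u w : nat) : bool :=
  [&& position (agents st i) == Some u, go d i == Some w & adj G u w].

(* An order to move to a non-neighbour is ignored. *)
Definition depart (R : realType) (k : nat) (G : wgraph R) (st : state R k)
    (d : decision R k) (i : 'I_k) : status R :=
  match agents st i, go d i with
  | At u, Some w =>
      if adj G u w then Transit u w (now st + len G u w) else At u
  | x, _ => x
  end.

Definition alarm (R : realType) (k : nat) (st : state R k)
    (d : decision R k) : seq R :=
  if timer d is Some t then if 0 < t then [:: now st + t] else [::] else [::].

(* Time stands still when no agent is moving and no timer is set. *)
Definition next_time (R : realType) (k : nat) (G : wgraph R) (st : state R k)
    (d : decision R k) : R :=
  let events :=
    alarm st d ++ pmap (fun i => arrival (depart G st d i)) (enum 'I_k) in
  if events is t :: ts then foldr Num.min t ts else now st.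

Definition arrive (R : realType) (t : R) (x : status R) : status R :=
  if x is Transit _ w a then if a <= t then At w else x else x.

Definition step (R : realType) (k : nat) (G : wgraph R) (st : state R k)
    (d : decision R k) : state R k :=
  let t := next_time G st d in
  let ag := fun i => arrive t (depart G st d i) in
  State t ag
    (fun v => visited st v || [exists i : 'I_k, position (ag i) == Some v]).

(* A controller decides on the basis of all states so far, latest first. *)
Definition controller (R : realType) (k : nat) := seq (state R k) -> decision R k.

Fixpoint history (R : realType) (k : nat) (G : wgraph R) (s : nat)
    (P : controller R k) (n : nat) : seq (state R k) :=
  if n is m.+1 then
    let h := history G s P m in step G (head (init_state R k s) h) (P h) :: h
  else [:: init_state R k s].

Definition run (R : realType) (k : nat) (G : wgraph R) (s : nat)
    (P : controller R k) (n : nat) : state R k :=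
  head (init_state R k s) (history G s P n).

Definition finished (R : realType) (k : nat) (G : wgraph R) (s : nat)
    (st : state R k) : Prop :=
  (forall v, v \in nodes G -> visited st v) /\
  (forall i, position (agents st i) = Some s).

(* The time at which the exploration is finished; +oo if it never is. *)
Definition run_cost (R : realType) (k : nat) (G : wgraph R) (s : nat)
    (P : controller R k) : \bar R :=
  ereal_inf [set (now (run G s P n))%:E | n in
    [set n : nat | finished G s (run G s P n)]]%classic.

(* Full prior knowledge: the controller may depend on G and s arbitrarily. *)
Definition is_opt (R : realType) (k : nat) (G : wgraph R) (s : nat) (o : R) : Prop :=
  (exists P : controller R k, run_cost G s P = o%:E) /\
  (forall P : controller R k, (o%:E <= run_cost G s P)%E).

(* [revealed u v] is the length of the edge uv if that edge exists and has been
   revealed, that is, if one of its end nodes has been visited. *)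
Record observation (R : realType) (k : nat) := Observation {
  obs_now : R;
  obs_agents : 'I_k -> status R;
  obs_visited : pred nat;
  revealed : nat -> nat -> option R
}.

Definition observe (R : realType) (k : nat) (G : wgraph R) (st : state R k) :
    observation R k :=
  Observation (now st) (agents st) (visited st)
    (fun u v => if adj G u v && (visited st u || visited st v)
                then Some (len G u v) else None).

Definition strategy (R : realType) (k : nat) :=
  seq (observation R k) -> decision R k.

Definition online (R : realType) (k : nat) (A : strategy R k) (G : wgraph R) :
    controller R k :=
  fun h => A (map (observe G) h).

Definition cost (R : realType) (k : nat) (A : strategy R k) (G : wgraph R)
    (s : nat) : \bar R :=
  run_cost G s (online A G).

(* An agent starts traversing an edge uw to an unvisited node w only if no
   edge vx to an unvisited node x, with some agent currently at v, is strictly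
   shorter.  An agent inside an edge makes no edge visible. *)
Definition ale_based (R : realType) (k : nat) (A : strategy R k) : Prop :=
  forall (G : wgraph R) (s : nat) (n : nat), s \in nodes G ->
  let st := run G s (online A G) n in
  let d := online A G (history G s (online A G) n) in
  forall (i : 'I_k) (u w : nat), departs G st d i u w -> ~~ visited st w ->
  ~ exists (j : 'I_k) (v x : nat),
      [/\ position (agents st j) = Some v, adj G v x, ~~ visited st x
        & len G v x < len G u w].

Definition competitive_ratio (R : realType) (k : nat) (A : strategy R k)
    (C : wgraph R -> Prop) : \bar R :=
  ereal_sup [set r | exists (G : wgraph R) (s : nat) (o : R),
    [/\ C G, s \in nodes G, is_opt k G s o
      & r = (cost A G s * (o^-1)%:E)%E]]%classic.

(* Main.v *)
Require Import Defs.
From mathcomp Require Import all_boot all_order all_algebra.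
From mathcomp Require Import finmap.
From mathcomp Require Import boolp classical_sets reals constructive_ereal ereal.
From mathcomp Require Import lra.
Set Implicit Arguments.
Unset Strict Implicit.
Unset Printing Implicit Defensive.
Import Order.TTheory GRing.Theory Num.Theory.
Local Open Scope ring_scope.

(* The lower bound needs no adaptive adversary: a triangle 0, 1, 2 with a tail
   edge 03 suffices, explored from 0, where the edges 01, 02, 03 have lengths
   1 - 2 eps, 1 - eps, 1 and the edge 12 has length 1.  With full knowledge three
   agents explore the three edges at 0 simultaneously, in time 2.  A strategy
   avoiding the longest edge cannot leave 0 through a longer edge before the
   shorter ones have been traversed completely, so node 3 is reached at time
   3 - 3 eps at the earliest, and the exploration takes time 4 - 3 eps. *)

(** * Event times and the effect of a single step *)

Lemma foldr_min_mem (R : realType) (x : R) (s : seq R) :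
  foldr Num.min x s \in x :: s.
Proof.
elim: s => [|y s IHs] /=; first exact: mem_head.
rewrite minEle; case: ifP => _; first by rewrite !inE eqxx orbT.
by move: IHs; rewrite !inE => /orP[->|->]; rewrite ?orbT.
Qed.

Lemma foldr_min_le (R : realType) (x y : R) (s : seq R) :
  y \in x :: s -> foldr Num.min x s <= y.
Proof.
elim: s => [|z s IHs] /=; first by rewrite inE => /eqP->.
rewrite ge_min !inE orbCA => /orP[/eqP->|ys]; first by rewrite lexx.
by rewrite IHs ?orbT // inE.
Qed.


Lemma next_time_le_arrival (R : realType) (k : nat) (G : wgraph R)
    (st : state R k) (d : decision R k) (i : 'I_k) (a : R) :
  arrival (depart G st d i) = Some a -> next_time G st d <= a.
Proof.
rewrite /next_time; set al := alarm st d; set ar := pmap _ _ => Eia.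
have a_ev : a \in al ++ ar.
  rewrite mem_cat mem_pmap; apply/orP; right; apply/mapP.
  by exists i => //; rewrite mem_enum.
by case: (al ++ ar) a_ev => [|t ts] //; exact: foldr_min_le.
Qed.

Lemma next_time_cases (R : realType) (k : nat) (G : wgraph R) (st : state R k)
    (d : decision R k) :
  [\/ next_time G st d = now st /\ (forall i, arrival (depart G st d i) = None),
      next_time G st d \in alarm st d
    | exists i, arrival (depart G st d i) = Some (next_time G st d)].
Proof.
rewrite /next_time; set al := alarm st d; set ar := pmap _ _.
case Eev: (al ++ ar) => [|t ts].
  apply: Or31; split=> // i; case Ei: (arrival _) => [a|] //.
  have : a \in al ++ ar.
    rewrite mem_cat mem_pmap; apply/orP; right; apply/mapP.
    by exists i => //; rewrite mem_enum.
  by rewrite Eev.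
have : foldr Num.min t ts \in al ++ ar by rewrite Eev foldr_min_mem.
rewrite mem_cat => /orP[->|]; first exact: Or32.
rewrite mem_pmap => /mapP[i _ Ei].
by apply: Or33; exists i; rewrite -Ei.
Qed.

Variant depart_spec (R : realType) (k : nat) (G : wgraph R) (st : state R k)
    (d : decision R k) (i : 'I_k) : status R -> Prop :=
| Stay : depart_spec G st d i (agents st i)
| Leave u w of departs G st d i u w & agents st i = At u :
    depart_spec G st d i (Transit u w (now st + len G u w)).

Lemma departP (R : realType) (k : nat) (G : wgraph R) (st : state R k)
    (d : decision R k) (i : 'I_k) :
  depart_spec G st d i (depart G st d i).
Proof.
rewrite /depart; case Eag: (agents st i) => [u|u v a]; last first.
  by rewrite -Eag; exact: Stay.
case Ego: (go d i) => [w|]; last by rewrite -Eag; exact: Stay.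
case: ifP => uw; last by rewrite -Eag; exact: Stay.
by apply: Leave => //; rewrite /departs Eag Ego uw !eqxx.
Qed.

Lemma departs_adj (R : realType) (k : nat) (G : wgraph R) (st : state R k)
    (d : decision R k) (i : 'I_k) (u w : nat) :
  departs G st d i u w -> adj G u w.
Proof. by case/and3P. Qed.

(** Pending arrivals lie strictly in the future, and timers and edge lengths are positive, so no
    event is scheduled in the past. *)
Lemma now_step (R : realType) (k : nat) (G : wgraph R) (st : state R k)
    (d : decision R k) :
  (forall i u v a, agents st i = Transit u v a -> now st < a) ->
  now st <= now (step G st d).
Proof.
move=> tra /=; case: (next_time_cases G st d) => [[->]//||[i]].
  rewrite /alarm; case: (timer d) => // t; case: ifP => // t_gt0.
  by rewrite inE => /eqP->; rewrite lerDl ltW.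
case: (departP G st d i) => [|u w /departs_adj uw _ /= [<-]].
  by case Eag: (agents st i) => [//|u v a] /= [<-]; apply/ltW/tra/Eag.
by rewrite lerDl ltW // len_gt0.
Qed.

(** * Lower bounds on exploration times *)

(* [T v] is a lower bound on the time at which v is first visited, and [D] one
   on the time needed to leave w. *)
Record paced (R : realType) (k : nat) (T : nat -> R) (w : nat) (D : R)
    (st : state R k) : Prop := Paced {
  paced_now : 0 <= now st;
  paced_visited : forall v, visited st v -> T v <= now st;
  paced_at : forall i v, agents st i = At v -> visited st v;
  paced_transit : forall i u v a, agents st i = Transit u v a ->
    now st < a /\ T v <= a;
  paced_leave : forall i v a, agents st i = Transit w v a -> T w + D <= a;
  paced_back : visited st w -> T w + D <= now st \/
    exists i, agents st i = At w \/ exists v a, agents st i = Transit w v a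
}.

(** An arrival time is fixed at departure, so the bounds [T] need checking only when an agent sets
    out. An agent leaving [w] does so at time [T w] or later and spends at least [D] on the edge. *)
Lemma paced_step (R : realType) (k : nat) (G : wgraph R) (T : nat -> R)
    (w : nat) (D : R) (st : state R k) (d : decision R k) :
  (forall x, adj G w x -> D <= len G w x) ->
  (forall i u v, visited st u -> departs G st d i u v ->
     T v <= now st + len G u v) ->
  paced T w D st -> paced T w D (step G st d).
Proof.
move=> lenD Tdep [now0 vis_T at_vis tr_T lv_D back].
have now_le : now st <= now (step G st d).
  by apply: now_step => i u v a /tr_T[].
have dep_tr i u v a : depart G st d i = Transit u v a -> T v <= a.
  case: (departP G st d i) => [/tr_T[]//|x y xy Ei [_ <- <-]].
  exact: Tdep (at_vis _ _ Ei) xy.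
have dep_lv i v a : depart G st d i = Transit w v a -> T w + D <= a.
  case: (departP G st d i) => [/lv_D//|x y xy Ei [Ex _ <-]].
  rewrite Ex in xy Ei *; have := vis_T _ (at_vis _ _ Ei).
  by move=> ?; rewrite lerD // lenD // (departs_adj xy).
have dep_at i v : depart G st d i = At v -> visited st v.
  by case: (departP G st d i) => [/at_vis|].
move: now_le dep_tr dep_lv dep_at; rewrite /step /=.
set t := next_time G st d => now_le dep_tr dep_lv dep_at.
have arr_at i v : arrive t (depart G st d i) = At v ->
    visited st v \/ T v <= t.
  case Ei: (depart G st d i) => [x|x y a] /=.
    by case=> <-; left; exact: dep_at Ei.
  case: ifP => // at_ [<-]; right; exact: le_trans (dep_tr _ _ _ _ Ei) at_.
have arr_tr i u v a : arrive t (depart G st d i) = Transit u v a ->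
    t < a /\ depart G st d i = Transit u v a.
  case: (depart G st d i) => [//|x y b] /=.
  by case: ifP => // /negbT; rewrite -ltNge => tb [<- <- <-].
split=> /=.
- exact: le_trans now_le.
- move=> v /orP[/vis_T Tv|]; first exact: le_trans now_le.
  move=> /existsP[i]; case Ei: (arrive _ _) => [x|] //= /eqP[Ex].
  case: (arr_at _ _ Ei); rewrite Ex // => /vis_T Tv; exact: le_trans now_le.
- by move=> i v Ei; apply/orP; right; apply/existsP; exists i; rewrite Ei.
- by move=> i u v a /arr_tr[ta /dep_tr].
- by move=> i v a /arr_tr[_ /dep_lv].
(* The agent witnessing that [w] was visited can stop being a witness only by completing an edge out
   of [w], hence not before [T w + D]. *)
case/orP => [/back[TD|[i Ei]]|].
- by left; exact: le_trans now_le.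
- have [Edep|[v [a Edep]]] : depart G st d i = At w \/
      exists v a, depart G st d i = Transit w v a.
  + case: departP => [//|x y _ Ex]; move: Ei; rewrite Ex => -[[->]|[? []]] //.
    by right; exists y; exists (now st + len G w y).
  + by right; exists i; left; rewrite Edep.
  have := dep_lv _ _ _ Edep => TDa.
  case: (leP a t) => [at_|ta]; first by left; exact: le_trans at_.
  by right; exists i; right; exists v; exists a; rewrite Edep /= leNgt ta.
- move=> /existsP[i]; case Ei: (arrive _ _) => [x|] //= /eqP[Ex].
  by right; exists i; left; rewrite Ei Ex.
Qed.

(** When all agents are at [s], none is at [w] or on an edge out of [w], so [paced_back] leaves only
    the time bound. The condition on departures may assume the bounds [T] for the nodes visited so
    far, which the induction supplies. *)
Lemma finished_ge (R : realType) (k : nat) (G : wgraph R) (s : nat)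
    (P : controller R k) (T : nat -> R) (w : nat) (D : R) :
  w \in nodes G -> w != s -> T s <= 0 ->
  (forall x, adj G w x -> D <= len G w x) ->
  (forall n, let st := run G s P n in
     0 <= now st -> (forall x, visited st x -> T x <= now st) ->
     forall i u v, visited st u -> departs G st (P (history G s P n)) i u v ->
     T v <= now st + len G u v) ->
  forall n, finished G s (run G s P n) -> T w + D <= now (run G s P n).
Proof.
move=> wG ws Ts lenD Tdep n [vis all_s].
have: paced T w D (run G s P n).
  elim: n {vis all_s} => [|n IHn].
    split=> //= [v /eqP->//|i v [<-]|]; first by rewrite eqxx.
    by rewrite (negPf ws).
  by apply: paced_step => //; case: IHn => *; eauto.
case=> _ _ _ _ _ /(_ (vis _ wG))[//|[i]].
have := all_s i; case: (agents _ i) => //= v [->] [[]|[? []]] // sw.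
by rewrite sw eqxx in ws.
Qed.

Lemma run_cost_ge (R : realType) (k : nat) (G : wgraph R) (s : nat)
    (P : controller R k) (r : R) :
  (forall n, finished G s (run G s P n) -> r <= now (run G s P n)) ->
  (r%:E <= run_cost G s P)%E.
Proof.
by move=> r_le; apply/ereal_infP => _ [n /r_le rn <-]; rewrite lee_fin.
Qed.

Lemma run_cost_eq (R : realType) (k : nat) (G : wgraph R) (s : nat)
    (P : controller R k) (n : nat) :
  finished G s (run G s P n) ->
  (forall m, finished G s (run G s P m) ->
     now (run G s P n) <= now (run G s P m)) ->
  run_cost G s P = (now (run G s P n))%:E.
Proof.
move=> fin /run_cost_ge min_n; apply/eqP; rewrite eq_le min_n andbT.
by apply: ereal_inf_lbound; exists n.
Qed.

(** * Full-knowledge exploration of a star around the start node *)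

(** A history of size 1 marks the initial decision. Later orders to go to [s] bring agents back; at
    [s] itself they are ignored because there are no loops, so returned agents stay. *)
Definition star_controller (R : realType) (k : nat) (s : nat)
    (dest : 'I_k -> nat) : controller R k :=
  fun h => Decision (fun i => Some (if size h == 1 then dest i else s)) None.

(* What agent i is doing at time t, just after the decision taken then. *)
Definition star_status (R : realType) (k : nat) (G : wgraph R) (s : nat)
    (dest : 'I_k -> nat) (t : R) (i : 'I_k) : status R :=
  let l := len G s (dest i) in
  if t < l then Transit s (dest i) l
  else if t < l + l then Transit (dest i) s (l + l) else At s.

(** Visits are recorded separately, since the status of a returned agent no longer shows them. *)
Definition on_schedule (R : realType) (k : nat) (G : wgraph R) (s : nat)
    (dest : 'I_k -> nat) (n : nat) (t : R) : Prop :=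
  let P : controller R k := star_controller s dest in
  [/\ now (run G s P n) = t,
      forall i, depart G (run G s P n) (P (history G s P n)) i =
        star_status G s dest t i
    & forall i, len G s (dest i) <= t -> visited (run G s P n) (dest i)].

Lemma on_schedule0 (R : realType) (k : nat) (G : wgraph R) (s : nat)
    (dest : 'I_k -> nat) :
  (forall i, adj G s (dest i)) -> on_schedule G s dest 0 0.
Proof.
move=> s_dest; split=> //= i; have l_gt0 := len_gt0 (s_dest i).
  by rewrite /depart /star_status /= s_dest l_gt0 add0r.
by rewrite leNgt l_gt0.
Qed.

(** The hypotheses make [t'] the first instant after [t] at which some agent reaches its destination
    or gets back to [s], so it is the next event. *)
Lemma on_schedule_step (R : realType) (k : nat) (G : wgraph R) (s : nat)
    (dest : 'I_k -> nat) (n : nat) (t t' : R) :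
  (forall i, adj G s (dest i)) -> t < t' ->
  (exists i, t' = len G s (dest i) \/ t' = len G s (dest i) + len G s (dest i)) ->
  (forall i, let l := len G s (dest i) in
     (t < l -> t' <= l) /\ (t < l + l -> t' <= l + l)) ->
  on_schedule G s dest n t -> on_schedule G s dest n.+1 t'.
Proof.
move=> s_dest tt' [j Ej] next; rewrite /on_schedule.
set P : controller R k := star_controller s dest => -[now_t dep vis].
set st := run G s P n in now_t dep vis.
have l_gt0 i : 0 < len G s (dest i) by exact: len_gt0.
have arr_ge i a : arrival (star_status G s dest t i) = Some a -> t' <= a.
  rewrite /star_status; have [n1 n2] := next i.
  case: ifP => [/n1 ? [<-] //|_]; case: ifP => [/n2 ? [<-]|] //.
have next_t' : next_time G st (P (history G s P n)) = t'.
  have arr_j : arrival (star_status G s dest t j) = Some t'.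
    have l0 := l_gt0 j; have [n1 _] := next j; rewrite /star_status.
    case: (ltP t) => [/n1 le|le]; case: Ej => E.
    - by rewrite E.
    - by exfalso; lra.
    - by exfalso; lra.
    - by rewrite -E tt'.
  apply/eqP; rewrite eq_le (next_time_le_arrival (i := j)) ?dep //=.
  (* The controller sets no timer, so the next event is an arrival. *)
  case: (next_time_cases G st (P (history G s P n))) => [[_ none]||[i]] //.
    by have := none j; rewrite dep arr_j.
  by rewrite dep => /arr_ge.
have ag i : agents (run G s P n.+1) i = arrive t' (star_status G s dest t i).
  by rewrite /= -/(run G s P n) -/st next_t' dep.
have now' : now (run G s P n.+1) = t' by [].
split=> // [i|i].
  have sz : (size (history G s P n.+1) == 1) = false by elim: (n).
  have [n1 n2] := next i; have l0 := l_gt0 i.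
  rewrite /depart ag now' /= -/(history G s P n.+1) sz /star_status.
  have ds : adj G (dest i) s by rewrite adj_sym.
  case: (ltP t (len _ _ _)) => [/n1 le_l|ge_l] /=.
    case: (leP (len _ _ _) t') => [ge_l|lt_l] /=.
      have -> : t' = len G s (dest i) by apply/eqP; rewrite eq_le le_l ge_l.
      by rewrite ds (len_sym ds) ltrDl l0.
    by [].
  rewrite [t' < len _ _ _]ltNge (le_trans ge_l (ltW tt')) /=.
  case: (ltP t (_ + _)) => [/n2 le_l|ge_ll] /=.
    case: (leP (_ + _) t') => [ge_ll|lt_l] /=; last by [].
    by rewrite (negbTE (_ : ~~ adj G s s)) ?adj_irr.
  by rewrite [t' < _]ltNge (le_trans ge_ll (ltW tt')) /= adj_irr.
rewrite /= -/(run G s P n) -/st => l_le.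
case: (leP (len G s (dest i)) t) => [/vis-> //|lt_l].
apply/orP; right; apply/existsP; exists i; rewrite next_t' dep.
by rewrite /star_status lt_l /= l_le.
Qed.

Lemma finished_on_schedule (R : realType) (k : nat) (G : wgraph R) (s : nat)
    (dest : 'I_k -> nat) (n : nat) (t : R) :
  (forall i, len G s (dest i) + len G s (dest i) <= t) ->
  (forall i, adj G s (dest i)) ->
  (forall v, v \in nodes G -> v = s \/ exists i, v = dest i) ->
  on_schedule G s dest n t ->
  finished G s (run G s (star_controller s dest) n).
Proof.
move=> l_le s_dest cover [now_t dep vis]; have l_gt0 i := len_gt0 (s_dest i).
have l_le1 i : len G s (dest i) <= t.
  by apply: le_trans (l_le i); rewrite lerDl ltW.
split=> [v /cover[->|[i ->]]|i]; last first.
(* Once every round trip is over, each agent is at [s] after the decision; a departure would have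
   put it in transit, so it was there before. *)
- have := dep i; rewrite /star_status !ltNge l_le l_le1 /=.
  by case: departP => [->|].
- exact: vis.
- elim: (n) => [|m IHm] /=; first exact: eqxx.
  by rewrite -/(run G s _ m) IHm.
Qed.

(** * The tadpole used as a bad instance *)

(** The sum of the labels singles out the edges 01, 02, 03, 12 and also fixes their lengths, so
    symmetry comes from commutativity of addition. *)
Definition kite_adj : rel nat := fun u v => (u != v) && (u + v <= 3)%N.

Definition kite_len (R : realType) (eps : R) (u v : nat) : R :=
  1 - eps *+ (3 - (u + v)).

Definition kite_nodes : {fset nat} := [fset 0%N; 1%N; 2%N; 3%N]%fset.

Lemma mem_kite_nodes v : (v \in kite_nodes) = (v <= 3)%N.
Proof. by rewrite !inE; case: v => [|[|[|[|v]]]]. Qed.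

Lemma kite_adjP u v : kite_adj u v ->
  (u, v) \in [:: (0, 1); (0, 2); (0, 3); (1, 0); (1, 2); (2, 0); (2, 1); (3, 0)]%N.
Proof.
by case: u => [|[|[|[|u]]]]; case: v => [|[|[|[|v]]]]; rewrite /kite_adj ?andbF.
Qed.

Lemma kite_adj_nodes u v :
  kite_adj u v -> (u \in kite_nodes) && (v \in kite_nodes).
Proof.
rewrite !mem_kite_nodes => /andP[_ uv3].
by rewrite (leq_trans (leq_addr v u) uv3) (leq_trans (leq_addl u v) uv3).
Qed.

Lemma kite_adj_sym : symmetric kite_adj.
Proof. by move=> u v; rewrite /kite_adj eq_sym addnC. Qed.

Lemma kite_adj_irr : irreflexive kite_adj.
Proof. by move=> u; rewrite /kite_adj eqxx. Qed.

Lemma kite_len_sym (R : realType) (eps : R) u v :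
  kite_adj u v -> kite_len eps u v = kite_len eps v u.
Proof. by rewrite /kite_len addnC. Qed.

Lemma kite_lenE (R : realType) (eps : R) :
  (kite_len eps 0 1 = 1 - 2 * eps) * (kite_len eps 0 2 = 1 - eps) *
  (kite_len eps 0 3 = 1) * (kite_len eps 1 2 = 1) * (kite_len eps 2 1 = 1) *
  (kite_len eps 1 0 = 1 - 2 * eps) * (kite_len eps 2 0 = 1 - eps) *
  (kite_len eps 3 0 = 1).
Proof. by rewrite /kite_len /= !mulr0n subr0 mulr1n mulr_natl. Qed.

Lemma kite_len_gt0 (R : realType) (eps : R) : 0 < eps < 1 / 4 ->
  forall u v, kite_adj u v -> 0 < kite_len eps u v.
Proof.
by move=> /andP[? ?] u v /kite_adjP; rewrite !inE;
  do !case/orP; move/eqP=> [-> ->]; rewrite kite_lenE; lra.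
Qed.

Lemma kite_connected u v : u \in kite_nodes -> v \in kite_nodes ->
  exists p : seq nat, path kite_adj u p && (last u p == v).
Proof.
rewrite !mem_kite_nodes => u3 v3.
exists (if u == 0 then if v == 0 then [::] else [:: v]
        else if v == 0 then [:: 0] else [:: 0; v])%N.
by move: u3 v3; case: u => [|[|[|[|u]]]] //; case: v => [|[|[|[|v]]]].
Qed.

Definition kite (R : realType) (eps : R) (eps_bnd : 0 < eps < 1 / 4) : wgraph R :=
  WGraph kite_adj_nodes kite_adj_sym kite_adj_irr (@kite_len_sym R eps)
    (kite_len_gt0 eps_bnd) kite_connected.

Lemma tadpole_kite (R : realType) (eps : R) (eps_bnd : 0 < eps < 1 / 4) :
  tadpole (kite eps_bnd).
Proof.
exists 0%N, [:: 1; 2]%N, [:: 3]%N; split=> //.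
  by move=> v; rewrite /= mem_kite_nodes !inE; case: v => [|[|[|[|v]]]].
move=> u v; rewrite /= /consecutive /kite_adj.
by case: u => [|[|[|[|u]]]]; case: v => [|[|[|[|v]]]]; rewrite /= ?andbF.
Qed.

(** * Optimal and online costs on the kite *)

Lemma kite_finished_ge2 (R : realType) (k : nat) (eps : R)
    (eps_bnd : 0 < eps < 1 / 4) (P : controller R k) (n : nat) :
  let G := kite eps_bnd in
  finished G 0 (run G 0 P n) -> 2 <= now (run G 0 P n).
Proof.
move=> G; rewrite -[2]/(1 + 1).
(* Node 3 can be entered and left only through the edge 03 of length 1. *)
apply: (finished_ge (T := fun v => (v == 3%N)%:R) (w := 3%N)) => // [|x|].
- by rewrite mem_kite_nodes.
- by move/kite_adjP; rewrite !inE /=; case: x => [|[|x]] //; rewrite kite_lenE.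
move=> m st now0 _ i u v _ /departs_adj uv; have len0 := len_gt0 uv.
move: uv len0 => /kite_adjP; rewrite !inE.
by do !case/orP; move/eqP=> [-> ->]; rewrite /= ?kite_lenE => ?; lra.
Qed.

Lemma kite_opt (R : realType) (k : nat) (eps : R) (eps_bnd : 0 < eps < 1 / 4) :
  (3 <= k)%N -> is_opt k (kite eps_bnd) 0 2.
Proof.
move=> k3; set G := kite eps_bnd.
have ge2 P n := @kite_finished_ge2 R k eps eps_bnd P n.
split; last by move=> P; apply: run_cost_ge => n; exact: ge2.
(* The first three agents take one edge each; any others accompany the third. *)
pose dest (i : 'I_k) := minn i.+1 3.
have /andP[eps0 eps4] := eps_bnd.
have destE i : [\/ dest i = 1%N, dest i = 2%N | dest i = 3%N].
  by rewrite /dest; case: i => [[|[|i]] ?] /=;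
    [exact: Or31|exact: Or32|exact: Or33].
have s_dest i : adj G 0 (dest i) by case: (destE i) => ->.
have dest_onto v : (0 < v <= 3)%N -> exists i, dest i = v.
  case: v => // v /= v3; exists (Ordinal (leq_trans v3 k3)).
  by rewrite /dest /=; apply/minn_idPl.
have next n (t t' : R) v : t < t' -> (0 < v <= 3)%N ->
    t' = len G 0 v \/ t' = len G 0 v + len G 0 v ->
    (forall w, (0 < w <= 3)%N -> (t < len G 0 w -> t' <= len G 0 w) /\
       (t < len G 0 w + len G 0 w -> t' <= len G 0 w + len G 0 w)) ->
    on_schedule G 0 dest n t -> on_schedule G 0 dest n.+1 t'.
  move=> tt' /dest_onto[j <-] Ej nx; apply: on_schedule_step => //.
    by exists j.
  by move=> i; apply: nx; case: (destE i) => ->.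
have forall3 (Q : nat -> Prop) : Q 1%N -> Q 2%N -> Q 3%N ->
    forall w, (0 < w <= 3)%N -> Q w.
  by move=> ? ? ? [|[|[|[|w]]]].
(* The six events are treated from last to first. The bound [eps < 1 / 4] gives [1 < 2 - 4 * eps]:
   all outward trips end before the first return. *)
have sched : on_schedule G 0 dest 6 (1 + 1).
  apply: (next _ ((1 - eps) + (1 - eps)) _ 3%N);
    [by lra|by []|by right; rewrite /= kite_lenE| | ].
    by apply: forall3; rewrite /= kite_lenE; split=> ?; lra.
  apply: (next _ ((1 - 2 * eps) + (1 - 2 * eps)) _ 2%N);
    [by lra|by []|by right; rewrite /= kite_lenE| | ].
    by apply: forall3; rewrite /= kite_lenE; split=> ?; lra.
  apply: (next _ 1 _ 1%N);
    [by lra|by []|by right; rewrite /= kite_lenE| | ].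
    by apply: forall3; rewrite /= kite_lenE; split=> ?; lra.
  apply: (next _ (1 - eps) _ 3%N);
    [by lra|by []|by left; rewrite /= kite_lenE| | ].
    by apply: forall3; rewrite /= kite_lenE; split=> ?; lra.
  apply: (next _ (1 - 2 * eps) _ 2%N);
    [by lra|by []|by left; rewrite /= kite_lenE| | ].
    by apply: forall3; rewrite /= kite_lenE; split=> ?; lra.
  apply: (next _ 0 _ 1%N);
    [by lra|by []|by left; rewrite /= kite_lenE| | ].
    by apply: forall3; rewrite /= kite_lenE; split=> ?; lra.
  exact: on_schedule0.
exists (star_controller 0%N dest).
have now6 : now (run G 0 (star_controller 0%N dest) 6) = 2 by case: sched.
rewrite -now6; apply: run_cost_eq => [|m fin]; last by rewrite now6; exact: ge2.
apply: finished_on_schedule sched => // [i|v].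
  by case: (destE i) => ->; rewrite /= kite_lenE; lra.
rewrite mem_kite_nodes; case: v => [|v] v3; first by left.
by right; have [i <-] := dest_onto v.+1 v3; exists i.
Qed.

(* At node 0, an avoid-longest-edge strategy may only leave for node v.+1 once
   node v has been visited, so the three edges at 0 are explored one after the
   other. *)
Lemma kite_ale_cost_ge (R : realType) (k : nat) (A : strategy R k) (eps : R)
    (eps_bnd : 0 < eps < 1 / 4) :
  ale_based A -> ((4 - 3 * eps)%:E <= cost A (kite eps_bnd) 0)%E.
Proof.
move=> ale; set G := kite eps_bnd; have /andP[eps0 eps4] := eps_bnd.
apply: run_cost_ge => n.
(* The entries are the partial sums of the lengths of 01, 02 and 03, traversed one after the
   other. *)
pose T v : R := nth 0 [:: 0; 1 - 2 * eps; 2 - 3 * eps; 3 - 3 * eps] v.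
have -> : 4 - 3 * eps = T 3%N + 1 by rewrite /T /=; lra.
move: n; apply: finished_ge => // [|x|].
- by rewrite mem_kite_nodes.
- by move/kite_adjP; rewrite !inE /=; case: x => [|[|x]] //; rewrite kite_lenE.
move=> n st now0 visT i u v vis_u dep; have uv := departs_adj dep.
have len0 := len_gt0 uv.
case: (boolP (visited st v)) => [/visT Tv|nvis_v].
  by apply: le_trans Tv _; rewrite lerDl ltW.
have Ei : position (agents st i) = Some u by case/and3P: dep => /eqP.
(* The departing agent itself sees the shorter edge. *)
have before x : adj G u x -> len G u x < len G u v -> visited st x.
  move=> ux lt_x; apply/negPn/negP => nvis_x.
  have /= := ale G 0%N n _ i u v dep nvis_v; rewrite mem_kite_nodes; apply=> //.
  by exists i, u, x.
move: uv before vis_u; rewrite /= => /kite_adjP; rewrite !inE.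
do !case/orP; move/eqP=> [-> ->]; rewrite /T /= ?kite_lenE => before vis_u.
- lra.
- have /visT : visited st 1%N by apply: before; rewrite ?kite_lenE //; lra.
  by rewrite /T /=; lra.
- have /visT : visited st 2%N by apply: before; rewrite ?kite_lenE //; lra.
  by rewrite /T /=; lra.
- lra.
(* Node 2 entered from node 1 along the cycle: time [2 - 2 * eps] at the earliest, so this is no
   shortcut. *)
- by move/visT: vis_u; rewrite /T /=; lra.
- lra.
- lra.
- lra.
Qed.

Theorem theorem1 (R : realType) (k : nat) (A : strategy R k) :
  (3 <= k)%N -> ale_based A ->
  (2%:E <= competitive_ratio A (@tadpole R))%E /\
  (forall c : R, c < 2 ->
     exists (G : wgraph R) (s : nat) (o : R),
       [/\ tadpole G, s \in nodes G, is_opt k G s o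
         & ((c * o)%:E < cost A G s)%E]).
Proof.
move=> k3 ale.
have bad c : c < 2 -> exists G : wgraph R,
    [/\ tadpole G, 0%N \in nodes G, is_opt k G 0 2
      & ((c * 2)%:E < cost A G 0)%E].
  (* The first bound keeps [eps] below [1 / 4]; the second gives [4 - 3 * eps >= 1 + 3 * c / 2],
     which exceeds [2 * c] as [c < 2]. *)
  move=> c2; pose eps : R := Num.min (1 / 5) ((2 - c) / 2).
  have eps_le : eps <= (2 - c) / 2 by rewrite ge_min lexx orbT.
  have eps_bnd : 0 < eps < 1 / 4.
    rewrite /eps lt_min gt_min; apply/andP; split; last by apply/orP; left; lra.
    by apply/andP; split; lra.
  exists (kite eps_bnd); split; [exact: tadpole_kite| |exact: kite_opt|].
    by rewrite mem_kite_nodes.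
  apply: lt_le_trans (kite_ale_cost_ge eps_bnd ale).
  by rewrite lte_fin; lra.
split=> [|c /bad[G [? ? ? ?]]]; last by exists G, 0%N, 2.
(* Each kite only yields a ratio bound below 2, so the supremum is compared with [2 - e] for every
   [e > 0]. *)
apply/lee_subgt0Pr => e e0.
have [|G [Gt G0 Gopt cost_gt]] := bad (2 - e); first by rewrite gtrBl.
apply: (@le_trans _ _ (cost A G 0 * (2^-1)%:E)%E).
  by rewrite lee_pdivlMr ?ltr0n //; exact: ltW.
by apply: ereal_sup_ubound; exists G, 0%N, 2.
Qed.
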